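(* Consider the finite-horizon mean-field game with data $(\mathcal S,\mathcal A,T,\mu_0,\{P_t\},\{r_t\})$ described in the context, and the constrained feasibility problem $$ \begin{array}{ll} \text{minimize}_{y,z,L} & 0\\ \text{subject to} & A_LL=b,\quad A_L^\top y+z=c_L,\\ & z^\top L=0,\quad L\ge 0,\quad z\ge 0, \end{array}\qquad(\star) $$ with $y\in\mathbb R^{S(T+1)}$, $z,L\in\mathbb R^{SA(T+1)}$. Finding a Nash equilibrium solution of the mean-field game is equivalent to solving $(\star)$, in the following sense. (i) If $(\pi,L)$ is a Nash equilibrium solution of the mean-field game, then there exist $y,z$ such that $(y,z,L)$ solves $(\star)$. (ii) If $(y,z,L)$ solves $(\star)$, then for every $\pi\in\Pi(L)$, $(\pi,L)$ is a Nash equilibrium solution of the mean-field game.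
   Context: **Mean-field game.** $\mathcal S,\mathcal A$ are finite sets with $|\mathcal S|=S$, $|\mathcal A|=A$; $T$ is a finite time horizon and $\mathcal T=\{0,1,\dots,T\}$. For a finite set $X$, $\Delta(X)$ is the set of probability vectors on $X$. $\mu_0\in\Delta(\mathcal S)$ is the initial distribution. For $t\in\mathcal T$, $s\in\mathcal S$, $a\in\mathcal A$ and $\ell\in\Delta(\mathcal S\times\mathcal A)$ there are a transition probability $P_t(\cdot|s,a,\ell)\in\Delta(\mathcal S)$ ($P_T$ plays no role) and a reward $r_t(s,a,\ell)\in\mathbb R$, with $r_{\max}:=\sup_{t,s,a,\ell}|r_t(s,a,\ell)|<\infty$. A policy (sequence) is $\pi=\{\pi_t\}_{t\in\mathcal T}$ with $\pi_t(\cdot|s)\in\Delta(\mathcal A)$; a mean-field flow is $L=\{L_t\}_{t\in\mathcal T}$ with $L_t\in\Delta(\mathcal S\times\mathcal A)$. For a flow $L$, $\mathcal M(L)$ is the MDP with initial law $s_0\sim\mu_0$, dynamics $s_{t+1}\sim P_t(\cdot|s_t,a_t,L_t)$ ($0\le t\le T-1$), controls $a_t\sim\pi_t(\cdot|s_t)$ ($t\in\mathcal T$) and objective to maximize $\mathbb E\big[\sum_{t=0}^T r_t(s_t,a_t,L_t)\big]$ over policies $\pi$. **Nash equilibrium solution.** $(\pi,L)$ is a Nash equilibrium solution if (1) $\pi$ is optimal for $\mathcal M(L)$; and (2) $L_0(s,a)=\mu_0(s)\pi_0(a|s)$ and $L_{t+1}(s',a')=\pi_{t+1}(a'|s')\sum_{s,a}L_t(s,a)P_t(s'|s,a,L_t)$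 for $t=0,\dots,T-1$. **The set $\Pi(L)$.** $\pi\in\Pi(L)$ iff $\pi_t(a|s)=L_t(s,a)/\sum_{a'}L_t(s,a')$ whenever $\sum_{a'}L_t(s,a')>0$, and $\pi_t(\cdot|s)$ is an arbitrary element of $\Delta(\mathcal A)$ otherwise. **Vectors and matrices.** Functions on $\mathcal S\times\mathcal A$ are flattened into vectors in $\mathbb R^{SA}$ in column-major order (state index running fastest), and flows are vectors $L=(L_0,\dots,L_T)\in\mathbb R^{SA(T+1)}$. Let $Z=[I_S,\dots,I_S]\in\mathbb R^{S\times SA}$ ($A$ copies of the identity), and let $W_t(L_t)\in\mathbb R^{S\times SA}$ be the matrix whose row indexed by $s'$ is the flattened vector $P_t(s'|\cdot,\cdot,L_t)$. Then $c_L=(-r_0(\cdot,\cdot,L_0),\dots,-r_T(\cdot,\cdot,L_T))\in\mathbb R^{SA(T+1)}$, $b=(0,\dots,0,\mu_0)\in\mathbb R^{S(T+1)}$, and $A_L\in\mathbb R^{S(T+1)\times SA(T+1)}$ has $T+1$ block rows: for $t=0,\dots,T-1$, block row $t$ has $W_t(L_t)$ in block column $t$, $-Z$ in block column $t+1$ and zeros elsewhere; the last block row has $Z$ in block column $0$ and zeros elsewhere. Since $P_t,r_t$ are defined only for $L_t\in\Delta(\mathcal S\times\mathcal A)$, the variable $L$ in $(\star)$ ranges over vectors with $L_t\in\Delta(\mathcal S\times\mathcal A)$ for all $t$. *)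

(* Defs.v *)
From HB Require Import structures.
From mathcomp Require Import all_boot all_order all_algebra.
From mathcomp Require Import reals.

Set Implicit Arguments.
Unset Strict Implicit.
Unset Printing Implicit Defensive.

Import Order.TTheory GRing.Theory Num.Theory.
Local Open Scope ring_scope.

Definition is_prob (R : realType) (X : finType) (p : {ffun X -> R}) : bool :=
  [forall x, 0 <= p x] && (\sum_x p x == 1).

(* The simplex Delta(X).  As [is_prob] is boolean, two elements with the same
   entries are equal. *)
Record simplex (R : realType) (X : finType) := Simplex {
  prob :> {ffun X -> R};
  probP : is_prob prob }.

HB.instance Definition _ (R : realType) (X : finType) :=
  [isSub for @prob R X].

(* [trans t s a l s'] is P_t(s' | s, a, l); the kernel at t = T is never used. *)
Record mfg (R : realType) (S A : finType) (T : nat) := Mfg {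
  mu0 : simplex R S;
  trans : 'I_T.+1 -> S -> A -> simplex R (S * A)%type -> simplex R S;
  reward : 'I_T.+1 -> S -> A -> simplex R (S * A)%type -> R;
  reward_bounded : exists M, forall t s a l, `|reward t s a l| <= M }.

(* [pi t s a] is pi_t(a | s). *)
Definition policy (R : realType) (S A : finType) (T : nat) :=
  'I_T.+1 -> S -> simplex R A.

Definition flow (R : realType) (S A : finType) (T : nat) :=
  'I_T.+1 -> simplex R (S * A)%type.

(* For t in {0, ..., T-1}: the times t and t+1 as elements of {0, ..., T}. *)
Definition now T (t : 'I_T) : 'I_T.+1 := widen_ord (leqnSn T) t.
Definition next T (t : 'I_T) : 'I_T.+1 := lift ord0 t.

Section MeanFieldGame.
Variables (R : realType) (S A : finType) (T : nat) (G : mfg R S A T).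
Implicit Types (pi : policy R S A T) (L : flow R S A T).

(* Law, on the finite space of trajectories, of (s_t, a_t)_{0 <= t <= T} in the
   decision process M(L) controlled by pi. *)
Definition traj_law L pi (w : {ffun 'I_T.+1 -> S * A}) : R :=
  mu0 G (w ord0).1
  * (\prod_(t < T.+1) pi t (w t).1 (w t).2)
  * (\prod_(t < T)
       trans G (now t) (w (now t)).1 (w (now t)).2 (L (now t)) (w (next t)).1).

Definition expected_return L pi : R :=
  \sum_w traj_law L pi w * (\sum_t reward G t (w t).1 (w t).2 (L t)).

Definition optimal L pi : Prop :=
  forall pi', expected_return L pi' <= expected_return L pi.

Definition consistent pi L : Prop :=
  (forall s a, L ord0 (s, a) = mu0 G s * pi ord0 s a)
  /\ (forall (t : 'I_T) s' a',
        L (next t) (s', a') =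
        pi (next t) s' a' *
        \sum_s \sum_a L (now t) (s, a) * trans G (now t) s a (L (now t)) s').

Definition nash_solution pi L : Prop := optimal L pi /\ consistent pi L.

(* pi t s is an arbitrary element of Delta(A) where L_t gives s no mass. *)
Definition induced_policy L pi : Prop :=
  forall t s, 0 < \sum_a' L t (s, a') ->
  forall a, pi t s a = L t (s, a) / \sum_a' L t (s, a').

(* Dimension S * A, split into A consecutive blocks of length S, one per
   action: this realizes the column-major order. *)
Definition dimSA : nat := (\sum_(a < #|A|) #|S|)%N.
Definition dimS_T : nat := (\sum_(t < T.+1) #|S|)%N.
Definition dimSA_T : nat := (\sum_(t < T.+1) dimSA)%N.

Definition flatten_sa (f : S -> A -> R) : 'cV[R]_dimSA :=
  \mxcol_(a < #|A|) \col_(s < #|S|) f (enum_val s) (enum_val a).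

Definition vec_flow L : 'cV[R]_dimSA_T :=
  \mxcol_(t < T.+1) flatten_sa (fun s a => L t (s, a)).

Definition Zmx : 'M[R]_(#|S|, dimSA) := \mxrow_(a < #|A|) (1%:M : 'M[R]_#|S|).

Definition Wmx (t : 'I_T.+1) (l : simplex R (S * A)%type) :
    'M[R]_(#|S|, dimSA) :=
  \matrix_(s' < #|S|)
    (flatten_sa (fun s a => trans G t s a l (enum_val s')))^T.

Definition Amx_block L (i j : 'I_T.+1) : 'M[R]_(#|S|, dimSA) :=
  if (i < T)%N then
    if j == i then Wmx i (L i)
    else if j == i.+1 :> nat then - Zmx else 0
  else if j == ord0 then Zmx else 0.

Definition Amx L : 'M[R]_(dimS_T, dimSA_T) :=
  \mxblock_(i < T.+1, j < T.+1) Amx_block L i j.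

Definition cvec L : 'cV[R]_dimSA_T :=
  \mxcol_(t < T.+1) flatten_sa (fun s a => - reward G t s a (L t)).

Definition bvec : 'cV[R]_dimS_T :=
  \mxcol_(t < T.+1)
    (if t == ord_max then \col_(s < #|S|) mu0 G (enum_val s) else 0).

(* The objective is constant, so solving the problem means being feasible. *)
Definition star_solution (y : 'cV[R]_dimS_T) (z : 'cV[R]_dimSA_T) L : Prop :=
  [/\ Amx L *m vec_flow L = bvec,
      (Amx L)^T *m y + z = cvec L,
      z^T *m vec_flow L = 0,
      (forall k, 0 <= vec_flow L k 0)
    & (forall k, 0 <= z k 0)].

End MeanFieldGame.

(* Main.v *)
From HB Require Import structures.
From mathcomp Require Import all_boot all_order all_algebra.
From mathcomp Require Import reals lra.
Require Import Defs.

(** The feasibility problem is the optimality system of the linear program for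
    the occupation measures of the decision process [M(L)], and everything
    reduces to one identity.  Fix a flow [L].  For arbitrary functions
    [U_t] on states put
      [slack_t(s,a) =
         U_t(s) - r_t(s,a,L_t) - sum_s' P_t(s'|s,a,L_t) U_(t+1)(s')],
    where the last sum is absent at the final time.  Along a trajectory the
    increments of [U] telescope in expectation, so that for every policy
      [expected return + E (sum_t slack_t(s_t,a_t)) = sum_s mu_0(s) U_0(s)]
    ([expected_return_slack]).  The right-hand side does not involve the
    policy: when [slack >= 0] it bounds every return, and a policy reaches the
    bound exactly when its trajectories almost surely meet only state-action
    pairs of slack 0.

    On the matrix side, the multiplier [y] is a shifted copy of such a [U]
    ([y_t = U_(t+1)] for [t < T], and [y_T = - U_0] because the constraint on
    the initial law sits in the last block row).  Under this change of variable
    the dual equation says [z = slack], the primal equation says that the state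
    marginals of [L] are transported by its own kernels, and [z^T L] is the sum
    of [L_t(s,a) slack_t(s,a)] ([star_solutionP]).  When [pi] generates [L],
    the law of [(s_t,a_t)] under [pi] is [L_t], so that this last sum is the
    expected total slack of [pi] ([consistent_marginal]).

    From an equilibrium, take for [U] the optimal value function: its slack is
    nonnegative and vanishes along a greedy policy, which therefore reaches the
    bound; since [pi] is optimal it reaches it too, hence [z^T L = 0].
    Conversely, a policy induced by a feasible [L] generates [L], its expected
    slack is [z^T L = 0], so it reaches the bound on all returns. *)

Set Implicit Arguments.
Unset Strict Implicit.
Unset Printing Implicit Defensive.

Import Order.TTheory GRing.Theory Num.Theory.
Local Open Scope ring_scope.

(** * Times and backward induction *)

Section Time.
Variable T : nat.

Lemma now_inj : injective (@now T).
Proof. by move=> i j /(congr1 val) /= /val_inj. Qed.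

Lemma now_next_neq (t : 'I_T) : now t == next t = false.
Proof. by apply/negbTE; rewrite -val_eqE /= /bump leq0n add1n neq_ltn ltnSn. Qed.

Lemma now_max_neq (t : 'I_T) : now t == ord_max = false.
Proof. by apply/negbTE; rewrite -val_eqE /= neq_ltn ltn_ord. Qed.

Lemma lift_maxE (t : 'I_T) : lift ord_max t = now t.
Proof. by apply: val_inj; exact: lift_max. Qed.

(** The horizon is the only time without a successor; every equation indexed
    by [t] in [{0, ..., T}] is split along this dichotomy. *)
Lemma max_or_now (t : 'I_T.+1) : t = ord_max \/ exists t', t = now t'.
Proof.
case: (unliftP ord_max t) => [j|] ->; last by left.
by right; exists j; rewrite lift_maxE.
Qed.

End Time.

Lemma now0 n : now (ord0 : 'I_n.+1) = ord0.
Proof. exact: val_inj. Qed.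

Lemma now_lift n (t : 'I_n) : now (lift ord0 t) = lift ord0 (now t).
Proof. exact: val_inj. Qed.

Lemma next_lift n (t : 'I_n) : next (lift ord0 t) = lift ord0 (next t).
Proof. by []. Qed.

Lemma lift0_max n : lift ord0 (ord_max : 'I_n.+1) = ord_max.
Proof. exact: val_inj. Qed.

(** Stated with relations rather than functions: the value function is then
    specified directly by its maximality, and the existence of a maximum is
    used one time step at a time. *)
Lemma backward_induction (Y : Type) n (final : Y -> Prop)
    (step : 'I_n -> Y -> Y -> Prop) :
  (exists u, final u) -> (forall t v, exists u, step t v u) ->
  exists v : 'I_n.+1 -> Y,
    final (v ord_max) /\ forall t, step t (v (next t)) (v (now t)).
Proof.
move=> [uT uTP]; elim: n step => [|n IHn] step stepP.
  by exists (fun=> uT); split=> // -[].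
have [v [vT vS]] := IHn (fun t => step (lift ord0 t)) (fun t => stepP _).
have [u uP] := stepP ord0 (v ord0).
exists (fun i => if unlift ord0 i is Some j then v j else u).
split; first by rewrite -lift0_max liftK.
move=> t; case: (unliftP ord0 t) => [j|] ->.
  by rewrite now_lift next_lift !liftK.
by rewrite now0 unlift_none liftK.
Qed.

(** * Expectations along Markov paths *)

Section PathSums.
Variables (R : pzRingType) (X : finType).

Definition path_cons n (x : X) (w : {ffun 'I_n -> X}) : {ffun 'I_n.+1 -> X} :=
  [ffun i => if unlift ord0 i is Some j then w j else x].

Lemma path_cons0 n x (w : {ffun 'I_n -> X}) : path_cons x w ord0 = x.
Proof. by rewrite ffunE unlift_none. Qed.

Lemma path_consS n x (w : {ffun 'I_n -> X}) i :
  path_cons x w (lift ord0 i) = w i.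
Proof. by rewrite ffunE liftK. Qed.

Lemma sum_path_cons n (F : {ffun 'I_n.+1 -> X} -> R) :
  \sum_w F w = \sum_x \sum_w F (path_cons x w).
Proof.
rewrite pair_bigA /= (reindex (fun p => path_cons p.1 p.2)) //=.
exists (fun w : {ffun 'I_n.+1 -> X} => (w ord0, [ffun i => w (lift ord0 i)])).
  move=> [x w] _ /=; rewrite path_cons0; congr pair.
  by apply/ffunP=> i; rewrite ffunE path_consS.
move=> w _; apply/ffunP=> i /=; rewrite ffunE.
by case: (unliftP ord0 i) => [j|] -> //; rewrite ffunE.
Qed.

(** [init] is an arbitrary function, not a probability: after the first step of
    a path has been summed out, the remaining path starts from a row [k ord0 x]
    of the kernel, which makes induction on the length possible. *)
Definition path_weight n (init : X -> R) (k : 'I_n -> X -> X -> R)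
    (w : {ffun 'I_n.+1 -> X}) : R :=
  init (w ord0) * \prod_(t < n) k t (w (now t)) (w (next t)).

Lemma path_weight_cons n init (k : 'I_n.+1 -> X -> X -> R) x w :
  path_weight init k (path_cons x w) =
  init x * path_weight (k ord0 x) (fun t => k (lift ord0 t)) w.
Proof.
rewrite /path_weight big_ord_recl path_cons0 now0 path_cons0 path_consS.
by congr (_ * (_ * _)); apply: eq_bigr => t _; rewrite now_lift !path_consS.
Qed.

Lemma sum_path0 (F : {ffun 'I_1 -> X} -> R) (f : X -> R) :
  (forall w, F w = f (w ord0)) -> \sum_w F w = \sum_x f x.
Proof.
move=> Ff; rewrite sum_path_cons; apply: eq_bigr => x _.
under eq_bigr do rewrite Ff path_cons0.
by rewrite sumr_const card_ffun card_ord expn0.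
Qed.

Definition stochastic n (k : 'I_n -> X -> X -> R) :=
  forall t x, \sum_y k t x y = 1.

Lemma path_weight_mass n init (k : 'I_n -> X -> X -> R) :
  stochastic k -> \sum_w path_weight init k w = \sum_x init x.
Proof.
elim: n init k => [|n IHn] init k k1.
  by apply: sum_path0 => w; rewrite /path_weight big_ord0 mulr1.
rewrite sum_path_cons; apply: eq_bigr => x _.
under eq_bigr do rewrite path_weight_cons.
by rewrite -mulr_sumr IHn ?k1 ?mulr1 // => t y; exact: k1.
Qed.

(** Dynamic programming, by induction on the length: once the first state [x]
    is fixed, the later rewards form the same problem started from the row
    [k ord0 x], and the first reward keeps its full weight because the paths
    that follow have total mass 1. *)
Lemma path_bellman n init (k : 'I_n -> X -> X -> R)
    (v h : 'I_n.+1 -> X -> R) :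
    stochastic k ->
    (forall x, v ord_max x = h ord_max x) ->
    (forall t x, v (now t) x = h (now t) x + \sum_y k t x y * v (next t) y) ->
  \sum_w path_weight init k w * (\sum_t h t (w t)) = \sum_x init x * v ord0 x.
Proof.
elim: n init k v h => [|n IHn] init k v h k1 vT vS.
  apply: (sum_path0 (f := fun x => init x * v ord0 x)) => w.
  rewrite /path_weight big_ord0 mulr1 big_ord1.
  by rewrite (_ : ord0 = ord_max) ?vT //; exact: val_inj.
have k'1 : stochastic (fun t => k (lift ord0 t)) by move=> t y; exact: k1.
rewrite sum_path_cons; apply: eq_bigr => x _.
under eq_bigr => w _.
  rewrite path_weight_cons -mulrA big_ord_recl path_cons0 mulrDr.
  under [in X in _ + X]eq_bigr do rewrite path_consS.
  over.
rewrite -mulr_sumr big_split /= -mulr_suml path_weight_mass // k1 mul1r.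
rewrite (IHn _ _ (fun t => v (lift ord0 t)) (fun t => h (lift ord0 t))) //.
- by rewrite -[in RHS]now0 vS now0.
- by move=> y; rewrite lift0_max.
- by move=> t y; rewrite -now_lift vS.
Qed.

(** The forward recursion for [D] and the backward recursion for the values [v]
    are adjoint: the pairing of [D t] with [h t] is a difference of two
    consecutive terms of [m t], the pairing of [D t] with [v t], and what is
    left after summation is [m ord0]. *)
Lemma path_marginal n init (k : 'I_n -> X -> X -> R)
    (D h : 'I_n.+1 -> X -> R) :
    stochastic k ->
    (forall x, D ord0 x = init x) ->
    (forall t y, D (next t) y = \sum_x D (now t) x * k t x y) ->
  \sum_w path_weight init k w * (\sum_t h t (w t)) =
  \sum_t \sum_x D t x * h t x.
Proof.
move=> k1 D0 DS.
have [v [vT vS]] := @backward_induction (X -> R) n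
  (fun u => forall x, u x = h ord_max x)
  (fun t v u => forall x, u x = h (now t) x + \sum_y k t x y * v y)
  (ex_intro _ (h ord_max) (fun=> erefl))
  (fun t v => ex_intro _ _ (fun=> erefl)).
rewrite (path_bellman _ k1 vT vS).
pose m t := \sum_x D t x * v t x.
have hm (t : 'I_n) : \sum_x D (now t) x * h (now t) x = m (now t) - m (next t).
  rewrite /m; apply/esym/eqP; rewrite subr_eq; apply/eqP.
  under eq_bigr do rewrite vS mulrDr.
  rewrite big_split /=; congr (_ + _).
  under [RHS]eq_bigr do rewrite DS mulr_suml.
  rewrite exchange_big; apply: eq_bigr => x _.
  by rewrite mulr_sumr; apply: eq_bigr => y _; rewrite mulrA.
have telescope :
    \sum_(t < n) m (now t) + m ord_max = m ord0 + \sum_(t < n) m (next t).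
  by rewrite -[RHS](big_ord_recl n m) big_ord_recr.
transitivity (m ord0); first by apply: eq_bigr => x _; rewrite D0.
rewrite big_ord_recr /= (eq_bigr _ (fun t _ => hm t)) sumrB.
under [X in _ = _ + X]eq_bigr do rewrite -vT.
by rewrite -/(m ord_max) addrAC telescope addrK.
Qed.

End PathSums.

(** * Probability vectors *)

Section Simplex.
Variables (R : realType) (X : finType).

Lemma prob_ge0 (p : simplex R X) x : 0 <= p x.
Proof. by have /andP[/forallP + _] := probP p; apply. Qed.

Lemma prob_sum1 (p : simplex R X) : \sum_x p x = 1.
Proof. by have /andP[_ /eqP] := probP p. Qed.

Lemma prob_inhabited (p : simplex R X) : inhabited X.
Proof.
have [x _|X0] := pickP (@predT X); first exact: inhabits x.
by have /eqP := prob_sum1 p; rewrite big_pred0 // eq_sym oner_eq0.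
Qed.

Lemma point_mass_prob (a : X) : is_prob [ffun x => (x == a)%:R : R].
Proof.
apply/andP; split; first by apply/forallP => x; rewrite ffunE ler0n.
rewrite (bigD1 a) //= ffunE eqxx big1 ?addr0 // => x /negbTE xa.
by rewrite ffunE xa.
Qed.

Definition point_mass a : simplex R X := Simplex (point_mass_prob a).

Lemma finite_argmax (f : X -> R) (x0 : X) : exists x, forall y, f y <= f x.
Proof.
exists [arg max_(x > x0) f x]%O.
by case: Order.TotalTheory.arg_maxP => // x _ fx y; exact: fx.
Qed.

End Simplex.

(** * Returns, slack and the dynamics of the game *)

Section MeanField.
Variables (R : realType) (S A : finType) (T : nat) (G : mfg R S A T).
Implicit Types (pi : policy R S A T) (L : flow R S A T) (U : 'I_T.+1 -> S -> R).

Definition init_law pi (x : S * A) : R := mu0 G x.1 * pi ord0 x.1 x.2.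

Definition kernel L pi (t : 'I_T) (x y : S * A) : R :=
  trans G (now t) x.1 x.2 (L (now t)) y.1 * pi (next t) y.1 y.2.

Lemma traj_lawE L pi w :
  traj_law G L pi w = path_weight (init_law pi) (kernel L pi) w.
Proof.
rewrite /traj_law /path_weight /init_law /kernel big_ord_recl big_split /=.
by rewrite -!mulrA; congr (_ * (_ * _)); rewrite mulrC.
Qed.

Lemma traj_law_ge0 L pi w : 0 <= traj_law G L pi w.
Proof.
by rewrite !mulr_ge0 ?prob_ge0 ?prodr_ge0 // => t _; exact: prob_ge0.
Qed.

(** The next action is drawn after the next state, so the policy drops out:
    this is why a single [U] serves all policies below. *)
Lemma sum_kernel L pi t x (f : S -> R) :
  \sum_y kernel L pi t x y * f y.1 =
  \sum_s trans G (now t) x.1 x.2 (L (now t)) s * f s.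
Proof.
rewrite -(pair_bigA _ (fun s a => kernel L pi t x (s, a) * f s)) /kernel /=.
by apply: eq_bigr => s _; rewrite -mulr_suml -mulr_sumr prob_sum1 mulr1.
Qed.

Lemma kernel_stochastic L pi : stochastic (kernel L pi).
Proof.
move=> t x; have := sum_kernel L pi t x (fun=> 1).
under eq_bigr do rewrite mulr1; move=> ->.
by under eq_bigr do rewrite mulr1; exact: prob_sum1.
Qed.

(** The sum over [t'] has one term, or none when [t] is the horizon. *)
Definition action_value L U (t : 'I_T.+1) s a : R :=
  reward G t s a (L t)
  + \sum_(t' < T | now t' == t)
      \sum_s' trans G (now t') s a (L (now t')) s' * U (next t') s'.

Lemma action_value_now L U t s a :
  action_value L U (now t) s a =
  reward G (now t) s a (L (now t))
  + \sum_s' trans G (now t) s a (L (now t)) s' * U (next t) s'.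
Proof.
by congr (_ + _); rewrite (big_pred1 t) // => t'; exact: (inj_eq (@now_inj T)).
Qed.

Lemma action_value_max L U s a :
  action_value L U ord_max s a = reward G ord_max s a (L ord_max).
Proof.
by rewrite /action_value big_pred0 ?addr0 // => t; exact: now_max_neq.
Qed.

Definition slack L U t s a : R := U t s - action_value L U t s a.

(** Applied to the reward [reward + slack], dynamic programming has solution
    [U] whatever the policy, because [U] depends on the state only. *)
Lemma expected_return_slack L U pi :
  expected_return G L pi
    + \sum_w traj_law G L pi w * (\sum_t slack L U t (w t).1 (w t).2)
  = \sum_s mu0 G s * U ord0 s.
Proof.
rewrite -big_split /=.
under eq_bigr do rewrite -mulrDr -big_split /= traj_lawE.
rewrite (path_bellman
  (h := fun t x => reward G t x.1 x.2 (L t) + slack L U t x.1 x.2) _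
  (@kernel_stochastic L pi) (v := fun t x => U t x.1)).
- rewrite -(pair_bigA _ (fun s a => init_law pi (s, a) * U ord0 s)) /init_law /=.
  by apply: eq_bigr => s _; rewrite -mulr_suml -mulr_sumr prob_sum1 mulr1.
- by move=> x; rewrite /slack action_value_max addrC subrK.
by move=> t x; rewrite (sum_kernel _ _ _ _ (U (next t))) addrAC
  -action_value_now addrC subrK.
Qed.

(** Consistency is the forward recursion for the law of the state-action pair
    under the kernel frozen at [L], so that law is [L t]. *)
Lemma consistent_marginal L pi (h : 'I_T.+1 -> S -> A -> R) :
  consistent G pi L ->
  \sum_w traj_law G L pi w * (\sum_t h t (w t).1 (w t).2) =
  \sum_t \sum_s \sum_a L t (s, a) * h t s a.
Proof.
move=> [L0 LS]; under eq_bigr do rewrite traj_lawE.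
rewrite (path_marginal (fun t x => h t x.1 x.2) (@kernel_stochastic L pi)
  (D := fun t x => L t x)).
- by apply: eq_bigr => t _; rewrite pair_bigA; apply: eq_bigr => -[].
- by move=> [s a]; exact: L0.
move=> t [s' a']; rewrite LS mulr_sumr; under eq_bigr do rewrite mulr_sumr.
rewrite pair_bigA; apply: eq_bigr => -[s a] _.
by rewrite /kernel /= mulrC mulrA.
Qed.

(** What remains of [consistent] once the action is summed out; no policy
    occurs in it, and it is what the primal constraints express. *)
Definition balanced L : Prop :=
  (forall s, \sum_a L ord0 (s, a) = mu0 G s)
  /\ (forall (t : 'I_T) s',
        \sum_a L (next t) (s', a) =
        \sum_s \sum_a L (now t) (s, a) * trans G (now t) s a (L (now t)) s').

Lemma consistent_balanced L pi : consistent G pi L -> balanced L.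
Proof.
move=> [L0 LS]; split=> [s|t s'].
  by under eq_bigr do rewrite L0; rewrite -mulr_sumr prob_sum1 mulr1.
by under eq_bigr do rewrite LS; rewrite -mulr_suml prob_sum1 mul1r.
Qed.

(** Clearing the denominator also covers the states of mass 0, where both
    sides vanish because [L t] is nonnegative. *)
Lemma induced_policyE L pi t s a :
  induced_policy L pi -> L t (s, a) = pi t s a * \sum_a' L t (s, a').
Proof.
move=> piL; have [m_gt0|m_le0] := ltP 0 (\sum_a' L t (s, a')).
  by rewrite piL // divfK ?gt_eqF.
have m0 : \sum_a' L t (s, a') = 0.
  by apply/le_anti; rewrite m_le0 sumr_ge0 // => a' _; exact: prob_ge0.
rewrite m0 mulr0; apply/eqP; move/eqP: m0.
rewrite psumr_eq0 => [/allP/(_ a)|a' _]; last exact: prob_ge0.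
by rewrite mem_index_enum; exact.
Qed.

Lemma balanced_consistent L pi :
  balanced L -> induced_policy L pi -> consistent G pi L.
Proof.
move=> [L0 LS] piL; split=> [s a|t s' a'].
  by rewrite (induced_policyE _ _ _ piL) L0 mulrC.
by rewrite (induced_policyE _ _ _ piL) LS.
Qed.

(** Backward induction on the Bellman optimality equation; [g] is a greedy
    policy for the optimal value [U]. *)
Lemma optimal_value_exists L (a0 : A) :
  exists U, exists g : 'I_T.+1 -> S -> A,
    (forall t s a, 0 <= slack L U t s a)
    /\ (forall t s, slack L U t s (g t s) = 0).
Proof.
have max_exists (q : S -> A -> R) :
    exists u : S -> R,
      forall s, (forall a, q s a <= u s) /\ exists a, q s a = u s.
  apply: (fin_all_exists (P := fun s u =>
    (forall a, q s a <= u) /\ exists a, q s a = u)) => s.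
  have [a qa] := finite_argmax (q s) a0.
  by exists (q s a); split=> //; exists a.
have [U [UT US]] := backward_induction
  (max_exists (fun s a => reward G ord_max s a (L ord_max)))
  (fun t v => max_exists (fun s a => reward G (now t) s a (L (now t))
    + \sum_s' trans G (now t) s a (L (now t)) s' * v s')).
have Umax t s : (forall a, action_value L U t s a <= U t s)
    /\ exists a, action_value L U t s a = U t s.
  have [->|[{}t ->]] := max_or_now t.
    have [ub [a Ua]] := UT s.
    split=> [b|]; first by rewrite action_value_max; exact: ub.
    by exists a; rewrite action_value_max; exact: Ua.
  have [ub [a Ua]] := US t s; split=> [b|]; first by rewrite action_value_now.
  by exists a; rewrite action_value_now.
exists U; have [g gP] : exists g : 'I_T.+1 -> S -> A,
    forall t s, action_value L U t s (g t s) = U t s.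
  apply: (fin_all_exists (P := fun t gt =>
    forall s, action_value L U t s (gt s) = U t s)) => t.
  apply: (fin_all_exists (P := fun s a => action_value L U t s a = U t s)) => s.
  by have [] := Umax t s.
exists g; split=> [t s a|t s]; last by rewrite /slack gP subrr.
by rewrite subr_ge0; have [+ _] := Umax t s; apply.
Qed.

End MeanField.

(** * The optimality system in coordinates *)

Section Matrices.
Variables (R : realType) (S A : finType) (T : nat) (G : mfg R S A T).
Implicit Types (L : flow R S A T) (U : 'I_T.+1 -> S -> R)
  (f : S -> A -> R) (u : S -> R) (z : 'I_T.+1 -> S -> A -> R).

Lemma sum_enum_val (X : finType) (F : X -> R) :
  \sum_(i < #|X|) F (enum_val i) = \sum_x F x.
Proof. by rewrite (reindex (@enum_val X X)) //; exact/onW_bij/enum_val_bij. Qed.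

Lemma mxcol_ge0 n (p : 'I_n -> nat) (B : forall i, 'cV[R]_(p i)) :
  (forall k, 0 <= (\mxcol_i B i) k 0) <-> (forall i j, 0 <= B i j 0).
Proof.
split=> [B_ge0 i j|B_ge0 k]; last by rewrite mxE; exact: B_ge0.
by rewrite -(mxcolK B i) mxE; exact: B_ge0.
Qed.

Definition col_vec u : 'cV[R]_#|S| := \col_s u (enum_val s).

Lemma col_vecP u v : col_vec u = col_vec v <-> u =1 v.
Proof.
split=> [/colP uv s|uv]; last by apply/colP=> i; rewrite !mxE.
by have := uv (enum_rank s); rewrite !mxE enum_rankK.
Qed.

Lemma flatten_saP f g : flatten_sa f = flatten_sa g <-> f =2 g.
Proof.
rewrite /flatten_sa -eq_mxcolP; split=> [fg s a|fg i].
  by have /colP/(_ (enum_rank s)) := fg (enum_rank a); rewrite !mxE !enum_rankK.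
by apply/colP=> j; rewrite !mxE.
Qed.

Lemma flatten_sa_ge0 f :
  (forall k, 0 <= flatten_sa f k 0) <-> (forall s a, 0 <= f s a).
Proof.
rewrite mxcol_ge0; split=> [f_ge0 s a|f_ge0 i j].
  by have := f_ge0 (enum_rank a) (enum_rank s); rewrite mxE !enum_rankK.
by rewrite mxE; exact: f_ge0.
Qed.

Lemma flatten_sa0 : flatten_sa (fun _ _ => 0) = 0 :> 'cV[R]_(dimSA S A).
Proof. by apply/colP=> k; rewrite !mxE. Qed.

Lemma flatten_saD f g :
  flatten_sa f + flatten_sa g = flatten_sa (fun s a => f s a + g s a).
Proof. by apply/colP=> k; rewrite !mxE. Qed.

Lemma flatten_saB f g :
  flatten_sa f - flatten_sa g = flatten_sa (fun s a => f s a - g s a).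
Proof. by apply/colP=> k; rewrite !mxE. Qed.

Lemma flatten_sa_sum (I : finType) (P : pred I) (f : I -> S -> A -> R) :
  \sum_(i | P i) flatten_sa (f i) =
  flatten_sa (fun s a => \sum_(i | P i) f i s a).
Proof.
by apply/colP=> k; rewrite summxE !mxE; apply: eq_bigr => i _; rewrite !mxE.
Qed.

Lemma flatten_sa_dot f g :
  (flatten_sa f)^T *m flatten_sa g = (\sum_s \sum_a f s a * g s a)%:M.
Proof.
rewrite tr_mxcol mul_mxrow_mxcol; apply/matrixP=> i j.
rewrite !ord1 summxE mxE eqxx mulr1n exchange_big /= -[RHS]sum_enum_val.
apply: eq_bigr => a _; rewrite !mxE -[RHS]sum_enum_val.
by apply: eq_bigr => s _; rewrite !mxE.
Qed.

Lemma mul_Zmx f : Zmx R S A *m flatten_sa f = col_vec (fun s => \sum_a f s a).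
Proof.
rewrite mul_mxrow_mxcol; apply/colP=> s.
rewrite summxE mxE -[RHS]sum_enum_val; apply: eq_bigr => a _.
by rewrite mul1mx mxE.
Qed.

Lemma mul_trZmx u : (Zmx R S A)^T *m col_vec u = flatten_sa (fun s _ => u s).
Proof.
rewrite tr_mxrow mxcol_mul; apply/eq_mxcolP=> a.
by rewrite trmx1 mul1mx.
Qed.

Lemma mul_Wmx t l f :
  Wmx G t l *m flatten_sa f =
  col_vec (fun s' => \sum_s \sum_a f s a * trans G t s a l s').
Proof.
apply/colP=> s'; rewrite [RHS]mxE.
have /matrixP/(_ 0 0) :=
  flatten_sa_dot (fun s a => trans G t s a l (enum_val s')) f.
rewrite [in X in _ = X -> _]mxE eqxx mulr1n.
under [in X in _ = X -> _]eq_bigr do under eq_bigr do rewrite mulrC.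
by move=> <-; rewrite !mxE; apply: eq_bigr => k _; rewrite [Wmx _ _ _ _ _]mxE.
Qed.

Lemma mul_trWmx t l u :
  (Wmx G t l)^T *m col_vec u =
  flatten_sa (fun s a => \sum_s' trans G t s a l s' * u s').
Proof.
apply/colP=> k; rewrite !mxE -[RHS]sum_enum_val.
by apply: eq_bigr => s' _; rewrite !mxE.
Qed.

(** The block of [y] at [t] is the multiplier of block row [t] of the primal
    constraints.  For [t < T] that row expresses the marginal at time [t+1],
    hence the shift; the last row is the constraint at time 0, and it carries
    [Z] where the others carry [- Z], hence the sign. *)
Definition multiplier U (t : 'I_T.+1) s : R :=
  if (t < T)%N then U (inord t.+1) s else - U ord0 s.

Lemma multiplier_now U t s : multiplier U (now t) s = U (next t) s.
Proof.
rewrite /multiplier /= ltn_ord; congr (U _ s).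
by apply: val_inj; rewrite /= inordK // ltnS.
Qed.

Lemma multiplier_max U s : multiplier U ord_max s = - U ord0 s.
Proof. by rewrite /multiplier ltnn. Qed.

Definition pack_multiplier U : 'cV[R]_(dimS_T S T) :=
  \mxcol_(t < T.+1) col_vec (multiplier U t).

Definition pack_slack z : 'cV[R]_(dimSA_T S A T) :=
  \mxcol_(t < T.+1) flatten_sa (z t).

(** Every [y] comes from some [U], so nothing is lost by the change of
    variable. *)
Lemma pack_multiplier_surj y : exists U, y = pack_multiplier U.
Proof.
pose u t s := submxcol y t (enum_rank s) 0.
exists (fun t =>
  if unlift ord0 t is Some t' then u (now t') else fun s => - u ord_max s).
apply/mxcolP=> t; rewrite mxcolK; apply/colP=> i; rewrite [RHS]mxE.
have [->|[{}t ->]] := max_or_now t.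
  by rewrite multiplier_max unlift_none opprK /u enum_valK.
by rewrite multiplier_now liftK /u enum_valK.
Qed.

Lemma pack_slack_surj (v : 'cV[R]_(dimSA_T S A T)) : exists z, v = pack_slack z.
Proof.
exists (fun t s a => submxcol (submxcol v t) (enum_rank a) (enum_rank s) 0).
apply/mxcolP=> t; rewrite mxcolK; apply/mxcolP=> a; rewrite mxcolK.
by apply/colP=> s; rewrite mxE !enum_valK.
Qed.

Lemma Amx_block_max L t :
  Amx_block G L ord_max t = if t == ord0 then Zmx R S A else 0.
Proof. by rewrite /Amx_block ltnn. Qed.

(** Written as a difference of two indicators, a block row can be summed over
    its columns, and a block column over its rows, one indicator at a time. *)
Lemma Amx_block_now L (i : 'I_T) t :
  Amx_block G L (now i) t =
  (if now i == t then Wmx G (now i) (L (now i)) else 0)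
  - (if next i == t then Zmx R S A else 0).
Proof.
rewrite /Amx_block /= ltn_ord [t == now i]eq_sym.
have -> : (t == i.+1 :> nat) = (next i == t) by rewrite eq_sym -val_eqE.
case: eqP => [<-|_]; first by rewrite eq_sym now_next_neq subr0.
by case: ifP => _; rewrite sub0r ?oppr0.
Qed.

Lemma mul_Amx L (f : 'I_T.+1 -> S -> A -> R) :
  Amx G L *m (\mxcol_(t < T.+1) flatten_sa (f t)) =
  \mxcol_(i < T.+1) \sum_t Amx_block G L i t *m flatten_sa (f t).
Proof. exact: mul_mxblock_mxrow. Qed.

Lemma primal_feasibleP L : Amx G L *m vec_flow L = bvec G <-> balanced G L.
Proof.
rewrite mul_Amx -eq_mxcolP.
have rowmax :
    \sum_t Amx_block G L ord_max t *m flatten_sa (fun s a => L t (s, a)) =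
    col_vec (fun s => \sum_a L ord0 (s, a)).
  rewrite (bigD1 ord0) //= big1 => [|t /negbTE t0]; rewrite Amx_block_max.
    by rewrite eqxx mul_Zmx addr0.
  by rewrite t0 mul0mx.
have rownow i :
    \sum_t Amx_block G L (now i) t *m flatten_sa (fun s a => L t (s, a)) =
    col_vec (fun s' => \sum_s \sum_a
      L (now i) (s, a) * trans G (now i) s a (L (now i)) s')
    - col_vec (fun s => \sum_a L (next i) (s, a)).
  under eq_bigr do rewrite Amx_block_now mulmxBl.
  rewrite sumrB -mul_Wmx -mul_Zmx; congr (_ - _).
    rewrite (bigD1 (now i)) //= eqxx big1 ?addr0 // => t /negbTE ti.
    by rewrite eq_sym ti mul0mx.
  rewrite (bigD1 (next i)) //= eqxx big1 ?addr0 // => t /negbTE ti.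
  by rewrite eq_sym ti mul0mx.
split=> [AL|[L0 LS] t].
  split.
    by have := AL ord_max; rewrite rowmax eqxx => /col_vecP.
  move=> t; have := AL (now t); rewrite rownow now_max_neq => /subr0_eq.
  by move=> /esym/col_vecP.
have [->|[{}t ->]] := max_or_now t.
  by rewrite rowmax eqxx; apply/col_vecP.
rewrite rownow now_max_neq; apply/eqP; rewrite subr_eq0; apply/eqP.
by apply/col_vecP => s; rewrite LS.
Qed.

(** In block column [t], the rows [i] with [now i = t] give the continuation
    value; the row [i] with [next i = t], or the last row if [t] is 0, gives
    [- U t]. *)
Lemma mul_trAmx L U :
  (Amx G L)^T *m pack_multiplier U =
  \mxcol_(t < T.+1) flatten_sa (fun s a =>
    action_value G L U t s a - reward G t s a (L t) - U t s).
Proof.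
rewrite tr_mxblock mul_mxblock_mxrow; apply/eq_mxcolP=> t.
rewrite big_ord_recr /= Amx_block_max.
have rownow (i : 'I_T) :
   (Amx_block G L (now i) t)^T *m col_vec (multiplier U (now i)) =
   (if now i == t
    then flatten_sa (fun s a =>
      \sum_s' trans G (now i) s a (L (now i)) s' * U (next i) s')
    else 0)
   - (if next i == t then flatten_sa (fun s a => U (next i) s) else 0).
  rewrite (_ : col_vec _ = col_vec (U (next i))); last first.
    by apply/col_vecP=> s; exact: multiplier_now.
  rewrite Amx_block_now linearB /= mulmxBl -mul_trZmx -mul_trWmx.
  by congr (_ - _); case: ifP => _ //; rewrite trmx0 mul0mx.
rewrite (eq_bigr _ (fun i _ => rownow i)) sumrB.
have -> : \sum_(i < T) (if now i == t
      then flatten_sa (fun s a =>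
        \sum_s' trans G (now i) s a (L (now i)) s' * U (next i) s')
      else 0)
    = flatten_sa (fun s a => action_value G L U t s a - reward G t s a (L t)).
  rewrite -big_mkcond flatten_sa_sum; apply/flatten_saP=> s a.
  by rewrite /action_value addrAC subrr add0r.
rewrite -[RHS]flatten_saB -addrA; congr (_ + _).
have [j|] := unliftP ord0 t => ->.
  rewrite -big_mkcond (big_pred1 j) => [|i]; last exact: (inj_eq lift_inj).
  by rewrite -[lift ord0 j == ord0]/false trmx0 mul0mx addr0.
rewrite big1 // oppr0 add0r eqxx mul_trZmx -[RHS]sub0r -flatten_sa0 flatten_saB.
by apply/flatten_saP=> s a; rewrite multiplier_max sub0r.
Qed.

Lemma dual_feasibleP L U z :
  (Amx G L)^T *m pack_multiplier U + pack_slack z = cvec G L <->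
  (forall t s a, z t s a = slack G L U t s a).
Proof.
rewrite mul_trAmx -mxcolD -eq_mxcolP.
split=> [dual t s a|zE t].
  have := dual t; rewrite flatten_saD => /flatten_saP/(_ s a).
  by rewrite /slack; lra.
by rewrite flatten_saD; apply/flatten_saP=> s a; rewrite zE /slack; lra.
Qed.

Lemma complementarityP L z :
  (pack_slack z)^T *m vec_flow L = 0 <->
  \sum_t \sum_s \sum_a L t (s, a) * z t s a = 0.
Proof.
have -> : (pack_slack z)^T *m vec_flow L
    = (\sum_t \sum_s \sum_a L t (s, a) * z t s a)%:M.
  rewrite tr_mxcol mul_mxrow_mxcol raddf_sum; apply: eq_bigr => t _.
  rewrite flatten_sa_dot; congr _%:M.
  by apply: eq_bigr => s _; apply: eq_bigr => a _; rewrite mulrC.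
by split=> [/matrixP/(_ 0 0)|->]; rewrite ?raddf0 // !mxE eqxx mulr1n.
Qed.

Lemma pack_slack_ge0 z :
  (forall k, 0 <= pack_slack z k 0) <-> (forall t s a, 0 <= z t s a).
Proof.
by rewrite mxcol_ge0; split=> z_ge0 t; exact/flatten_sa_ge0/z_ge0.
Qed.

Lemma star_solutionP L U z :
  star_solution G (pack_multiplier U) (pack_slack z) L <->
  [/\ balanced G L, (forall t s a, z t s a = slack G L U t s a),
      \sum_t \sum_s \sum_a L t (s, a) * z t s a = 0
    & forall t s a, 0 <= z t s a].
Proof.
split=> [[/primal_feasibleP ? /dual_feasibleP ? /complementarityP ? _
  /pack_slack_ge0 ?] //|].
move=> [? ? ? ?]; split.
- exact/primal_feasibleP.
- exact/dual_feasibleP.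
- exact/complementarityP.
- by apply/(pack_slack_ge0 (fun t s a => L t (s, a))) => t s a; exact: prob_ge0.
- exact/pack_slack_ge0.
Qed.

End Matrices.

(** * Equilibria and solutions *)

Section Equivalence.
Variables (R : realType) (S A : finType) (T : nat) (G : mfg R S A T).
Implicit Types (pi : policy R S A T) (L : flow R S A T).

(** The multipliers are the optimal values and the slack their Bellman
    residual: complementarity holds since an optimal policy cannot lose any
    slack compared with a greedy one. *)
Lemma nash_star_solution pi L :
  nash_solution G pi L -> exists y z, star_solution G y z L.
Proof.
move=> [pi_opt piL].
have [s0] := prob_inhabited (mu0 G); have [a0] := prob_inhabited (pi ord0 s0).
have [U [g [slack_ge0 slack_g]]] := optimal_value_exists G L a0.
exists (pack_multiplier U), (pack_slack (slack G L U)).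
apply/star_solutionP; split=> //; first exact: consistent_balanced piL.
apply/le_anti/andP; split; last first.
  do 3![apply: sumr_ge0 => ? _].
  by rewrite mulr_ge0 ?prob_ge0.
rewrite -(consistent_marginal _ piL).
have := pi_opt (fun t s => point_mass R (g t s)).
(* Optimality bounds the expected slack of [pi] by that of the greedy policy. *)
rewrite -(lerD2r (\sum_w traj_law G L pi w
  * (\sum_t slack G L U t (w t).1 (w t).2))).
rewrite expected_return_slack.
rewrite -(expected_return_slack G L U (fun t s => point_mass R (g t s))).
rewrite lerD2l => /le_trans; apply.
rewrite big1 // => w _.
(* A trajectory that leaves the greedy actions has weight 0. *)
have [/forallP wg|] := boolP [forall t, (w t).2 == g t (w t).1].
  by rewrite big1 ?mulr0 // => t _; rewrite (eqP (wg t)) slack_g.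
rewrite negb_forall => /existsP[t /negbTE wt].
rewrite /traj_law (bigD1 t) //= ffunE wt.
by rewrite !(mul0r, mulr0).
Qed.

(** Weak duality: [sum_s mu0(s) U_0(s)] bounds every return, and
    complementarity says that an induced policy attains it. *)
Lemma star_solution_nash y z L pi :
  star_solution G y z L -> induced_policy L pi -> nash_solution G pi L.
Proof.
have [U ->] := pack_multiplier_surj y; have [{}z ->] := pack_slack_surj z.
move=> /star_solutionP[L_bal zE zL0 z_ge0] piL.
have cons := balanced_consistent L_bal piL; split=> // pi'.
have value_pi : expected_return G L pi = \sum_s mu0 G s * U ord0 s.
  rewrite -(expected_return_slack G L U pi) (consistent_marginal _ cons).
  rewrite [X in _ + X](_ : _ = 0) ?addr0 // -[RHS]zL0.
  by do 3![apply: eq_bigr => ? _]; rewrite zE.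
rewrite value_pi -(expected_return_slack G L U pi') lerDl sumr_ge0 // => w _.
rewrite mulr_ge0 ?traj_law_ge0 // sumr_ge0 // => t _.
by rewrite -zE.
Qed.

End Equivalence.

Theorem theorem4 (R : realType) (S A : finType) (T : nat) (G : mfg R S A T) :
  (forall (pi : policy R S A T) (L : flow R S A T),
     nash_solution G pi L ->
     exists (y : 'cV[R]_(dimS_T S T)) (z : 'cV[R]_(dimSA_T S A T)),
       star_solution G y z L)
  /\
  (forall (y : 'cV[R]_(dimS_T S T)) (z : 'cV[R]_(dimSA_T S A T))
          (L : flow R S A T),
     star_solution G y z L ->
     forall pi : policy R S A T, induced_policy L pi -> nash_solution G pi L).
Proof.
split=> [pi L|y z L star pi]; first exact: nash_star_solution.
exact: star_solution_nash star.
Qed.
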